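(* Consider the plant $$\dot x=Ax+Bw,\qquad y=Cx+Dw,$$ with $x(t)\in\mathbb{R}^n$, $w(t)\in\mathbb{R}^m$, $y(t)\in\mathbb{R}^k$ and real matrices $A,B,C,D$ of corresponding sizes, where $(C,A)$ is detectable, $(A,B)$ is controllable, $BD^\top=0$ and $DD^\top$ is invertible. Let $C_z\in\mathbb{R}^{\bar k\times n}$. For $L\in\mathbb{R}^{n\times k}$ consider the observer $\dot{\hat x}=A\hat x+L(\hat y-y)$, $\hat y=C\hat x$, the error output $z=C_z(x-\hat x)$, and let $\mathcal{S}_L$ be the resulting closed-loop system with input $w$ and output $z$, i.e., with $e=x-\hat x$, $\dot e=(A+LC)e+(B+LD)w$, $z=C_ze$. Let $\alpha>0$ and let $P_\alpha\succ 0$ be the positive definite solution of $$AP_\alpha+P_\alpha A^\top+\alpha P_\alpha-\alpha P_\alpha C^\top(DD^\top)^{-1}CP_\alpha+\frac1\alpha BB^\top=0.$$ Then the observer with $$L=-\alpha P_\alpha C^\top(DD^\top)^{-1}$$ renders $\mathcal{S}_L$ stable (i.e. $A+LC$ is stable) and guarantees that its $\varepsilon(\alpha)$-norm possesses the smallest possible value (among all gain matrices in $\mathbb{R}^{n\times k}$ for which the $\varepsilon(\alpha)$-norm of the closed-loop system is defined), which is equal to $$\|\mathcal{S}_L\|_{\varepsilon(\alpha)}=\sqrt{\operatorname{trace}(C_zP_\alpha C_z^\top)}.$$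
   Context: A matrix is stable if all its eigenvalues have strictly negative real parts. For a system $\mathcal{S}:\ \dot x=\mathcal{A}x+\mathcal{B}w,\ z=\mathcal{C}x$ with input $w$ and output $z$, and $\alpha>0$, the $\varepsilon(\alpha)$-norm is defined when $\mathcal{A}+\frac\alpha2 I$ is stable (equivalently $\alpha\in(0,-2r)$, $r<0$ the largest real part of the eigenvalues of $\mathcal{A}$), by $$\|\mathcal{S}\|_{\varepsilon(\alpha)}^2:=\operatorname{trace}(\mathcal{C}P\mathcal{C}^\top)=\operatorname{trace}(\mathcal{B}^\top Q\mathcal{B}),$$ where $P,Q$ are the unique solutions of $\mathcal{A}P+P\mathcal{A}^\top+\alpha P+\frac1\alpha\mathcal{B}\mathcal{B}^\top=0$ and $Q\mathcal{A}+\mathcal{A}^\top Q+\alpha Q+\frac1\alpha\mathcal{C}^\top\mathcal{C}=0$. *)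

(* Defs.v *)
From HB Require Import structures.
From mathcomp Require Import all_boot all_order all_algebra.
From mathcomp Require Import complex.
From mathcomp Require Import all_classical all_reals all_analysis.
Set Implicit Arguments.
Unset Strict Implicit.
Unset Printing Implicit Defensive.
Import Order.TTheory GRing.Theory Num.Theory.
Import numFieldNormedType.Exports.
Local Open Scope ring_scope.

(* The eigenvalues are the complex ones, hence the embedding into R[i]. *)
Definition stable (R : realType) (n : nat) (A : 'M[R]_n) : Prop :=
  forall lambda : R[i],
    eigenvalue (map_mx (real_complex R) A) lambda -> complex.Re lambda < 0.

Definition posdef (R : realType) (n : nat) (P : 'M[R]_n) : Prop :=
  P^T = P /\ forall x : 'cV[R]_n, x != 0 -> 0 < (x^T *m P *m x) 0 0.

Definition detectable (R : realType) (n k : nat)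
    (C : 'M[R]_(k, n)) (A : 'M[R]_n) : Prop :=
  exists L : 'M[R]_(n, k), stable (A + L *m C).

(* Any state x0 can be steered to any state x1 in finite time along
   x' = A x + B u.  Signals live on the whole line: a continuous input on
   [0, T] extends continuously to R, and the trajectory extends with it. *)
Definition controllable (R : realType) (n m : nat)
    (A : 'M[R]_n) (B : 'M[R]_(n, m)) : Prop :=
  forall x0 x1 : 'cV[R]_n,
  exists (T : R) (u : R -> 'cV[R]_m) (x : R -> 'cV[R]_n),
    [/\ 0 < T,
        forall j : 'I_m, continuous (fun t : R => u t j 0),
        forall (t : R) (i : 'I_n),
          is_derive t 1 (fun s : R => x s i 0) ((A *m x t + B *m u t) i 0),
        x 0 = x0
      & x T = x1].

(* The system x' = A x + B w, z = C x. *)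
Record lti (R : realType) (n m p : nat) := LTI {
  lti_state : 'M[R]_n;
  lti_input : 'M[R]_(n, m);
  lti_output : 'M[R]_(p, n)
}.

Definition eps_norm_defined (R : realType) (n m p : nat) (alpha : R)
    (S : lti R n m p) : Prop :=
  stable (lti_state S + (alpha / 2)%:M).

(* When eps_norm_defined alpha S holds (and 0 < alpha), this Lyapunov equation
   has exactly one solution; the default value 0 is then irrelevant. *)
Definition eps_gramian (R : realType) (n m p : nat) (alpha : R)
    (S : lti R n m p) : 'M[R]_n :=
  let A := lti_state S in
  let B := lti_input S in
  xget 0 [set P : 'M[R]_n |
    A *m P + P *m A^T + alpha *: P + alpha^-1 *: (B *m B^T) = 0]%classic.

Definition eps_norm (R : realType) (n m p : nat) (alpha : R)
    (S : lti R n m p) : R :=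
  Num.sqrt (\tr (lti_output S *m eps_gramian alpha S *m (lti_output S)^T)).

(* Dynamics of e = x - xh for the plant x' = A x + B w, y = C x + D w and the
   observer xh' = A xh + L (C xh - y), with output z = Cz e:
   e' = A e + B w - L (C xh - C x - D w) = (A + L C) e + (B + L D) w. *)
Definition error_system (R : realType) (n m k p : nat)
    (A : 'M[R]_n) (B : 'M[R]_(n, m)) (C : 'M[R]_(k, n)) (D : 'M[R]_(k, m))
    (Cz : 'M[R]_(p, n)) (L : 'M[R]_(n, k)) : lti R n m p :=
  LTI (A + L *m C) (B + L *m D) Cz.

(* Main.v *)
Require Import Defs.
From HB Require Import structures.
From mathcomp Require Import all_boot all_order all_algebra.
From mathcomp Require Import complex.
From mathcomp Require Import all_classical all_reals all_analysis.
From mathcomp Require Import ring.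
Set Implicit Arguments.
Unset Strict Implicit.
Unset Printing Implicit Defensive.
Import Order.TTheory GRing.Theory Num.Theory.
Import numFieldNormedType.Exports.
Local Open Scope ring_scope.

(** Put F = A + L C + (alpha/2) I and M = B + L D for a gain L.  The equation
    that defines the eps(alpha)-gramian X of the closed loop is the Lyapunov
    equation F X + X F^T + alpha^-1 M M^T = 0, and completing the square in L
    in the Riccati equation ([riccati_defect]) shows that P satisfies
      F' P + P F'^T + alpha^-1 M' M'^T
        = alpha^-1 (L' - L) D D^T (L' - L)^T
    for every gain L', where F' and M' are formed with L' and L is the gain of
    the theorem.

    For L' = L the right-hand side vanishes, so P is the gramian of the optimal
    loop as soon as F is stable.  Stability follows from P > 0
    ([lyapunov_stable]): evaluating the equation at a left eigenvector of F
    shows that a real part >= 0 forces the eigenvector to be killed by M.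
    Since M D^T = L D D^T, it is then killed by L and by B, so it is a left
    eigenvector of A killed by B, which controllability forbids
    ([controllable_left_eigenvector]).

    For another admissible L' with gramian X, subtracting the two equations
    gives F' (X - P) + (X - P) F'^T + G G^T = 0, and stability of F' yields
    X >= P ([lyapunov_psd]), hence the trace inequality.

    The Lyapunov theory is obtained algebraically, without the matrix
    exponential: by Schur's theorem F may be taken triangular, and then uniqueness
    is an induction on the entries ([sylvester_trig_inj]) and positivity an
    induction on the size ([lyapunov_trig_psd]).  Uniqueness gives solvability because the Lyapunov
    operator is an endomorphism of a finite-dimensional space. *)

(** * Lyapunov equations with a triangular coefficient *)

(** Lower triangular A and upper triangular B make the (i, j) entry of the
    equation involve only entries of X of index sum at most i + j, the one of
    index (i, j) itself with coefficient A i i + B j j. *)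
Lemma sylvester_trig_inj (F : fieldType) m n (A : 'M[F]_m) (B : 'M[F]_n)
    (X : 'M[F]_(m, n)) :
  is_trig_mx A -> is_trig_mx B^T ->
  (forall i j, A i i + B j j != 0) -> A *m X + X *m B = 0 -> X = 0.
Proof.
move=> /is_trig_mxP tA /is_trig_mxP tB nz eqX.
suff H s (i : 'I_m) (j : 'I_n) : (i + j < s)%N -> X i j = 0.
  by apply/matrixP => i j; rewrite mxE (H (i + j).+1).
elim: s i j => [//|s IHs] i j lts.
have /matrixP/(_ i j) := eqX; rewrite !mxE (bigD1 i) //= [X in _ + X](bigD1 j) //=.
rewrite big1 ?addr0 => [|k neki]; last first.
  have [ltik|ltki|eqik] := ltngtP i k; first by rewrite tA ?mul0r.
    by rewrite IHs ?mulr0 // (leq_trans _ (lts : (i + j <= s)%N)) // ltn_add2r.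
  by case/eqP: neki; apply/val_inj.
rewrite big1 ?addr0 => [|k nekj]; last first.
  have [ltjk|ltkj|eqjk] := ltngtP j k.
  - by have := tB _ _ ltjk; rewrite mxE => ->; rewrite mulr0.
  - by rewrite IHs ?mul0r // (leq_trans _ (lts : (i + j <= s)%N)) // ltn_add2l.
  by case/eqP: nekj; apply/val_inj.
rewrite mulrC -mulrDr => /eqP; rewrite mulf_eq0 => /orP[/eqP //|].
by rewrite (negPf (nz i j)).
Qed.

Section ComplexLyapunov.
Variable C : numClosedFieldType.
Local Open Scope sesquilinear_scope.

Lemma adjmxM m n p (A : 'M[C]_(m, n)) (B : 'M[C]_(n, p)) :
  (A *m B)^t* = B^t* *m A^t*.
Proof. by rewrite trmx_mul map_mxM. Qed.

Lemma adjmxD m n (A B : 'M[C]_(m, n)) : (A + B)^t* = A^t* + B^t*.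
Proof. by rewrite linearD map_mxD. Qed.

Lemma adjmxN m n (A : 'M[C]_(m, n)) : (- A)^t* = - A^t*.
Proof. by rewrite linearN map_mxN. Qed.

Lemma mul_adjmx_ge0 n (u : 'rV[C]_n) : 0 <= (u *m u^t*) 0 0.
Proof. by rewrite -dotmxE dnorm_ge0. Qed.

Lemma mul_adjmx_eq0 n (u : 'rV[C]_n) : u *m u^t* = 0 -> u = 0.
Proof.
move=> uu0; apply/eqP/negPn/negP => /dotmx_is_dotmx.
by rewrite dotmxE uu0 mxE ltxx.
Qed.

Lemma addr_conj_neq0 (a b : C) : a + a^* < 0 -> b + b^* < 0 -> a + b^* != 0.
Proof.
move=> a0 b0; apply/eqP => ab0; have : a + a^* + (b + b^*) < 0.
  by rewrite -(addr0 0) ltrD.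
have -> : a + a^* + (b + b^*) = (a + b^*) + (a + b^*)^*.
  by rewrite rmorphD /= conjCK; ring.
by rewrite ab0 rmorph0 addr0 ltxx.
Qed.

(** Induction by Schur complement.  In blocks, let F = [l 0; u F1],
    X = [e d^*; d X1] and G = [g; H].  The corner of the equation reads
    (l + l^* ) e = - g g^*, so e >= 0.  There is a column c with d = - c e: this
    is clear if e is nonzero, and if e = 0 then g = 0 and the lower left block
    of the equation becomes F1 d + d l^* = 0, so d = 0.  The Schur complement
    S = X1 + c d^* solves the Lyapunov equation of F1 with the factor H + c g,
    so it is positive by induction, and
    (a w) X (a w)^* = (a - w c) e (a - w c)^* + w S w^*. *)
Lemma lyapunov_trig_psd m n (F X : 'M[C]_n) (G : 'M[C]_(n, m)) :
    is_trig_mx F -> (forall i, F i i + (F i i)^* < 0) -> X^t* = X ->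
    F *m X + X *m F^t* + G *m G^t* = 0 ->
  forall v : 'rV[C]_n, 0 <= (v *m X *m v^t*) 0 0.
Proof.
elim: n F X G => [|n IHn] F X G tF sF hX eqX v.
  by rewrite [v *m X]thinmx0 mul0mx mxE.
move: F X G v tF sF hX eqX; rewrite -[n.+1]/(1 + n)%N => F X G v tF sF hX eqX.
have /is_trig_mxP tF' := tF.
move: hX eqX; rewrite -[F]submxK -[X]submxK -[G]vsubmxK.
have Fur0 : ursubmx F = 0.
  by apply/matrixP => i j; rewrite !mxE tF' //= (ord1 i).
rewrite Fur0.
have tF1 : is_trig_mx (drsubmx F).
  by apply/is_trig_mxP => i j ltij; rewrite !mxE tF' //= ltn_add2l.
have sF1 i : drsubmx F i i + (drsubmx F i i)^* < 0 by rewrite !mxE; exact: sF.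
have sl : ulsubmx F 0 0 + (ulsubmx F 0 0)^* < 0 by rewrite !mxE; exact: sF.
move: (ulsubmx F) (dlsubmx F) (drsubmx F) sl tF1 sF1 => l u F1 sl tF1 sF1.
move: (ulsubmx X) (ursubmx X) (dlsubmx X) (drsubmx X) => e d' d X1.
move: (usubmx G) (dsubmx G) => g H.
rewrite !tr_block_mx tr_col_mx map_row_mx !map_block_mx.
move=> /eq_block_mx [he hd' hd hX1]; subst d'.
rewrite !mulmx_block mul_col_row !add_block_mx !trmx0 !map_mx0.
rewrite !(mul0mx, mulmx0, add0r, addr0) -[0 in RHS]block_mx0.
move=> /eq_block_mx [e11 _ e21 e22].
have [c dE] : exists c : 'M[C]_(n, 1), d = - (c *m e).
  have [e0|eN0] := eqVneq e 0; last first.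
    exists (- (e 0 0)^-1 *: d); rewrite [e]mx11_scalar mul_mx_scalar scalerA.
    rewrite !mxE /= mulr1n mulrN divff ?scaleN1r ?opprK //.
    by apply: contra eN0 => /eqP e0; rewrite [e]mx11_scalar e0 rmorph0.
  exists 0; rewrite mul0mx oppr0.
  move: e11; rewrite e0 mulmx0 mul0mx !add0r => /mul_adjmx_eq0 g0.
  move: e21; rewrite e0 g0 trmx0 map_mx0 !mulmx0 add0r addr0 => e21.
  apply: sylvester_trig_inj e21 => // [|i j].
    by apply/is_trig_mxP => i j; rewrite !ord1.
  by rewrite !ord1 !mxE addr_conj_neq0.
have dE' : d^t* = - (e *m c^t*) by rewrite dE adjmxN adjmxM he.
pose S := X1 + c *m d^t*.
have hS : S^t* = S.
  by rewrite /S adjmxD adjmxM hX1 trmxCK dE' dE mulmxN mulNmx mulmxA.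
have eqS : F1 *m S + S *m F1^t* + (H + c *m g) *m (H + c *m g)^t* = 0.
  have e21' : u *m d^t* =
      (F1 *m d + d *m l^t* + H *m g^t*) *m c^t*.
    have -> : F1 *m d + d *m l^t* + H *m g^t* = - (u *m e).
      by apply/eqP; rewrite -addr_eq0 -e21 addrC !addrA.
    by rewrite dE' mulmxN mulNmx mulmxA.
  have e12' : d *m u^t* =
      c *m (d^t* *m F1^t* + l *m d^t* + g *m H^t*).
    by rewrite -[d in LHS]trmxCK -adjmxM e21' adjmxM !adjmxD !adjmxM !trmxCK.
  have e11' : c *m g *m g^t* *m c^t* =
      - (c *m l *m e *m c^t*) - c *m e *m l^t* *m c^t*.
    have -> : c *m g *m g^t* = - (c *m l *m e) - c *m e *m l^t*.
      rewrite -mulmxA -[g *m _]addr0 -(subrr (l *m e + e *m l^t*)).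
      rewrite addrA (addrC (g *m _)) e11 sub0r opprD mulmxDr !mulmxN.
      by rewrite !mulmxA.
    by rewrite mulmxDl !mulNmx.
  move: e22; rewrite e21' e12' /S !adjmxD !adjmxM.
  rewrite !(mulmxDl, mulmxDr) !mulmxA e11'.
  have -> : F1 *m c *m d^t* = F1 *m d *m c^t*.
    by rewrite dE' dE !(mulmxN, mulNmx) !mulmxA.
  rewrite dE' dE !(mulmxN, mulNmx) !mulmxA.
  rewrite !addrA => e22'; rewrite -[RHS]e22'.
  by rewrite [LHS](ACl (2 * 9 * 6 * 1 * 4 * 8 * 7 * 3 * 5)%AC).
have psdS := IHn _ _ _ tF1 sF1 hS eqS.
have -> : v *m block_mx e (d^t*) d X1 *m v^t* =
    (lsubmx v - rsubmx v *m c) *m e *m (lsubmx v - rsubmx v *m c)^t*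
    + rsubmx v *m S *m (rsubmx v)^t*.
  rewrite -[v in LHS]hsubmxK; move: (lsubmx v) (rsubmx v) => a w.
  rewrite mul_row_block tr_row_mx map_col_mx mul_row_col /S.
  rewrite adjmxD adjmxN adjmxM !(mulmxDl, mulmxDr, mulmxN, mulNmx, opprK).
  rewrite !mulmxA dE' dE !(mulmxN, mulNmx) !mulmxA ?opprK.
  by rewrite -!addrA; do 3!congr (_ + _); rewrite addrC subrK.
rewrite mxE addr_ge0 //.
rewrite [e]mx11_scalar mul_mx_scalar -scalemxAl mxE mulr_ge0 ?mul_adjmx_ge0 //.
rewrite -(nmulr_rle0 _ sl).
have -> : (l 0 0 + (l 0 0)^*) * e 0 0 = - (g *m g^t*) 0 0.
  apply/eqP; rewrite -addr_eq0; apply/eqP.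
  move/matrixP/(_ 0 0): e11; move: (g *m _) => q.
  rewrite [l]mx11_scalar [e]mx11_scalar.
  by rewrite tr_scalar_mx map_scalar_mx -!scalar_mxM !mxE /= !mulr1n => <-; ring.
by rewrite oppr_le0 mul_adjmx_ge0.
Qed.

(** * Schur reduction of stable Lyapunov equations *)

(** The condition a + a^* < 0 says that the real part of a is negative, in a
    form available in any numerically closed field. *)
Definition hurwitz n (F : 'M[C]_n) := forall a, eigenvalue F a -> a + a^* < 0.

Lemma hurwitz_trig n (F : 'M[C]_n) : hurwitz F ->
  exists U T : 'M[C]_n, [/\ U *m U^t* = 1%:M, U^t* *m U = 1%:M, is_trig_mx T,
    (forall i, T i i + (T i i)^* < 0) & U *m F = T *m U].
Proof.
move=> sF; have [U uU /andP[tT _]] := cotrigonalization2 (erefl (F *m F)).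
have UU : U *m U^t* = 1%:M by apply/unitarymxP.
have UU' := mulmx1C UU.
move: tT; rewrite /similar_to conjymx //; set T := _ *m _ *m _ => tT.
have UF : U *m F = T *m U by rewrite /T -!mulmxA UU' mulmx1.
exists U, T; split=> // i; apply: sF.
have : eigenvalue T (T i i).
  rewrite eigenvalue_root_char char_poly_trig //.
  rewrite -(big_map _ predT (fun x => 'X - x%:P)).
  by rewrite root_prod_XsubC; apply/mapP; exists i; rewrite ?mem_index_enum.
case/eigenvalueP => v vT v0; apply/eigenvalueP; exists (v *m U).
  by rewrite -mulmxA UF mulmxA vT scalemxAl.
apply: contraNneq v0 => vU0.
by rewrite -(mulmx1 v) -UU mulmxA vU0 mul0mx.
Qed.

Lemma lyapunov_conj_inj n (F X : 'M[C]_n) :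
  hurwitz F -> F *m X + X *m F^t* = 0 -> X = 0.
Proof.
move=> /hurwitz_trig [U [T [UU UU' tT sT UF]]] eqX.
have UF' : F^t* *m U^t* = U^t* *m T^t* by rewrite -!adjmxM UF.
have Y0 : U *m X *m U^t* = 0.
  apply: (@sylvester_trig_inj _ _ _ T (T^t*)) => //.
  - apply/is_trig_mxP => i j ltij; rewrite !mxE.
    by rewrite (is_trig_mxP tT) // rmorph0.
  - by move=> i j; rewrite !mxE addr_conj_neq0.
  rewrite !mulmxA -UF -!mulmxA -UF' !mulmxA -mulmxDl -2!mulmxA -mulmxDr.
  by rewrite eqX mulmx0 mul0mx.
have -> : X = U^t* *m (U *m X *m U^t*) *m U.
  by rewrite !mulmxA UU' mul1mx -mulmxA UU' mulmx1.
by rewrite Y0 mulmx0 mul0mx.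
Qed.

Lemma lyapunov_conj_psd m n (F X : 'M[C]_n) (G : 'M[C]_(n, m)) :
    hurwitz F -> X^t* = X ->
    F *m X + X *m F^t* + G *m G^t* = 0 ->
  forall v : 'rV[C]_n, 0 <= (v *m X *m v^t*) 0 0.
Proof.
move=> /hurwitz_trig [U [T [UU UU' tT sT UF]]] hX eqX v.
have UF' : F^t* *m U^t* = U^t* *m T^t* by rewrite -!adjmxM UF.
have -> : v *m X *m v^t* = v *m U^t* *m (U *m X *m U^t*) *m (v *m U^t*)^t*.
  rewrite adjmxM trmxCK -!mulmxA (mulmxA _ U) UU' mul1mx.
  by rewrite (mulmxA _ U) UU' mul1mx.
apply: (@lyapunov_trig_psd _ _ T _ (U *m G)) => //.
  by rewrite !adjmxM trmxCK hX mulmxA.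
rewrite adjmxM !mulmxA -UF -(mulmxA _ (U^t*)) -UF' !mulmxA.
by rewrite -!mulmxDl -!(mulmxA U) -!mulmxDr eqX mulmx0 mul0mx.
Qed.
End ComplexLyapunov.

(** * Real Lyapunov equations *)

Section RealLyapunov.
Variable R : realType.
Local Notation toC := (map_mx (real_complex R)).

Lemma stable_hurwitz n (F : 'M[R]_n) : stable F -> hurwitz (toC F).
Proof.
move=> sF a /sF a0; have -> : a + a^* = 2 * (complex.Re a)%:C%C by exact: addcJ.
by rewrite pmulr_rlt0 ?ltr0n // ltcR.
Qed.

Lemma toC_adj m n (A : 'M[R]_(m, n)) : ((toC A)^t*)%sesqui = toC A^T.
Proof. by apply/matrixP => i j; rewrite !mxE; exact: conjc_real. Qed.

Lemma toC_inj m n : injective (fun A : 'M[R]_(m, n) => toC A).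
Proof. exact: map_mx_inj. Qed.

Lemma lyapunov_inj n (F X : 'M[R]_n) :
  stable F -> F *m X + X *m F^T = 0 -> X = 0.
Proof.
move=> /stable_hurwitz sF eqX; apply: toC_inj; rewrite map_mx0.
apply: lyapunov_conj_inj sF _.
by rewrite toC_adj -!map_mxM -map_mxD eqX map_mx0.
Qed.

Lemma lyapunov_psd m n (F X : 'M[R]_n) (G : 'M[R]_(n, m)) :
    stable F -> X^T = X -> F *m X + X *m F^T + G *m G^T = 0 ->
  forall v : 'rV[R]_n, 0 <= (v *m X *m v^T) 0 0.
Proof.
move=> /stable_hurwitz sF hX eqX v.
have := @lyapunov_conj_psd _ _ _ _ (toC X) (toC G) sF _ _ (toC v).
rewrite !toC_adj -!map_mxM -!map_mxD hX eqX map_mx0 !mxE ler0c.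
exact.
Qed.

Lemma lyapunov_unique n (F Q X Y : 'M[R]_n) : stable F ->
  F *m X + X *m F^T + Q = 0 -> F *m Y + Y *m F^T + Q = 0 -> X = Y.
Proof.
move=> sF eqX eqY; apply/eqP; rewrite -subr_eq0; apply/eqP.
apply: (lyapunov_inj sF); rewrite mulmxBr mulmxBl addrACA -opprD.
by apply/eqP; rewrite subr_eq0 -(inj_eq (addIr Q)) eqX eqY.
Qed.

Lemma lyapunov_sym n (F Q X : 'M[R]_n) : stable F -> Q^T = Q ->
  F *m X + X *m F^T + Q = 0 -> X^T = X.
Proof.
move=> sF symQ eqX; apply: (lyapunov_unique sF _ (eqX)).
have := congr1 trmx eqX; rewrite trmx0 2!linearD /= !trmx_mul trmxK symQ.
by rewrite [X^T *m _ + _]addrC.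
Qed.

(** An injective endomorphism of the space of matrices is onto. *)
Lemma lyapunov_solvable n (F Q : 'M[R]_n) :
  stable F -> exists X, F *m X + X *m F^T + Q = 0.
Proof.
move=> sF; pose f X := F *m X + X *m F^T.
have f_lin : linear f.
  by move=> k X Y; rewrite /f mulmxDl mulmxDr -scalemxAl -scalemxAr scalerDr addrACA.
pose fL := GRing.isLinear.Build R _ _ _ f f_lin.
pose g : {linear 'M[R]_n -> 'M[R]_n} := HB.pack f fL.
have : row_full (lin_mx g).
  rewrite row_full_unit -row_free_unit; apply: inj_row_free => v v0.
  apply: (can_inj vec_mxK); rewrite linear0; apply: (lyapunov_inj sF).
  by apply: (can_inj mxvecK); rewrite -[_ + _]/(g (vec_mx v)) -mul_rV_lin v0 linear0.
case/row_fullP => M MK.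
exists (vec_mx (- mxvec Q *m M)).
have : g (vec_mx (- mxvec Q *m M)) = - Q.
  by rewrite -mx_rV_lin -mulmxA MK mulmx1 linearN /= mxvecK.
by rewrite /= /f => ->; rewrite addNr.
Qed.

(** * Real and imaginary parts of left eigenvectors *)

Lemma mul_trmx_ge0 n (u : 'rV[R]_n) : 0 <= (u *m u^T) 0 0.
Proof. by rewrite mxE sumr_ge0 // => i _; rewrite mxE -expr2 sqr_ge0. Qed.

Lemma mul_trmx_eq0 n (u : 'rV[R]_n) : (u *m u^T) 0 0 = 0 -> u = 0.
Proof.
rewrite mxE => /eqP; rewrite psumr_eq0 => [/allP u0|i _]; last first.
  by rewrite mxE -expr2 sqr_ge0.
apply/rowP => i; have := u0 i (mem_index_enum i).
by rewrite !mxE mulf_eq0 orbb => /eqP.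
Qed.

(** Splitting a complex left eigenvector into a + i b keeps all later estimates
    and differential equations over the reals. *)
Lemma eigenvalue_real_parts n (F : 'M[R]_n) (l : R[i]) : eigenvalue (toC F) l ->
  exists a b : 'rV[R]_n, [/\ (a != 0) || (b != 0),
    a *m F = complex.Re l *: a - complex.Im l *: b &
    b *m F = complex.Im l *: a + complex.Re l *: b].
Proof.
case/eigenvalueP => v vF v0.
have reM (z w : R[i]) : complex.Re (z * w) =
    complex.Re z * complex.Re w - complex.Im z * complex.Im w.
  by case: z w => [? ?] [? ?].
have imM (z w : R[i]) : complex.Im (z * w) =
    complex.Re z * complex.Im w + complex.Im z * complex.Re w.
  by case: z w => [? ?] [? ?].
have reD : {morph (@complex.Re R) : x y / x + y} by move=> [? ?] [? ?].
have imD : {morph (@complex.Im R) : x y / x + y} by move=> [? ?] [? ?].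
exists (map_mx (@complex.Re R) v), (map_mx (@complex.Im R) v); split.
- apply: contraNT v0; rewrite negb_or !negbK => /andP[/eqP a0 /eqP b0].
  apply/eqP/rowP => j; move/rowP/(_ j): a0; move/rowP/(_ j): b0.
  by rewrite !mxE; case: (v 0 j) => x y /= -> ->.
- apply/rowP => j; move/rowP/(_ j)/(congr1 (@complex.Re R)): vF.
  rewrite !mxE reM => <-; rewrite (big_morph _ reD (erefl _)).
  by apply: eq_bigr => i _; rewrite reM !mxE /= mulr0 subr0.
- apply/rowP => j; move/rowP/(_ j)/(congr1 (@complex.Im R)): vF.
  rewrite !mxE imM addrC => <-; rewrite (big_morph _ imD (erefl _)).
  by apply: eq_bigr => i _; rewrite imM !mxE /= mulr0 add0r.
Qed.

(** * Controllability and left eigenvectors *)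

Lemma is_derive_mulmx n (a : 'rV[R]_n) (x : R -> 'cV[R]_n) (dx : 'cV[R]_n) (t : R) :
  (forall i, is_derive t 1 (fun s => x s i 0) (dx i 0)) ->
  is_derive t 1 (fun s => (a *m x s) 0 0) ((a *m dx) 0 0).
Proof.
move=> dxi; rewrite mxE.
have -> : (fun s => (a *m x s) 0 0) = \sum_(i < n) (a 0 i \*: (fun s => x s i 0)).
  by apply/funext => s; rewrite mxE fct_sumE.
exact: is_derive_sum.
Qed.

(** The easy half of the Popov-Belevitch-Hautus test.  Along any trajectory the
    input does not act on f = a x and g = b x, and (f^2 + g^2)' = 2 p (f^2 + g^2).
    Hence a trajectory from the origin has f = g = 0 for ever, although
    controllability lets it reach every basis vector. *)
Lemma controllable_left_eigenvector n m (A : 'M[R]_n) (B : 'M[R]_(n, m))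
    (a b : 'rV[R]_n) (p q : R) :
  controllable A B ->
  a *m A = p *: a - q *: b -> b *m A = q *: a + p *: b ->
  a *m B = 0 -> b *m B = 0 -> a = 0 /\ b = 0.
Proof.
move=> ctr aA bA aB bB.
suff H i : a 0 i = 0 /\ b 0 i = 0.
  by split; apply/rowP => i; rewrite mxE; case: (H i).
have [T [u [x [_ _ dx x0 xT]]]] := ctr 0 (delta_mx i 0).
pose f t := (a *m x t) 0 0; pose g t := (b *m x t) 0 0.
have lin2 r r' (M N : 'M[R]_1) : (r *: M + r' *: N) 0 0 = r * M 0 0 + r' * N 0 0.
  by rewrite !mxE.
have df (t : R) : is_derive t (1 : R) f (p * f t - q * g t).
  have := is_derive_mulmx a (dx t).
  rewrite mulmxDr !mulmxA aA aB mul0mx addr0 mulmxBl -!scalemxAl.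
  by rewrite -scaleNr lin2 mulNr.
have dg (t : R) : is_derive t (1 : R) g (q * f t + p * g t).
  have := is_derive_mulmx b (dx t).
  by rewrite mulmxDr !mulmxA bA bB mul0mx addr0 mulmxDl -!scalemxAl lin2.
(* The weight exp (- 2 p t) makes f^2 + g^2 constant. *)
pose h t := expR ((- 2 * p) * t) * (f t ^+ 2 + g t ^+ 2).
have h_cst s t : h s = h t.
  apply: is_derive_0_is_cst => {}t.
  pose c := - 2 * p.
  have dl : is_derive t (1 : R) (fun t => c * t) c.
    by have := is_deriveZ c (is_derive_id t (1 : R)); rewrite /GRing.scale /= mulr1.
  have de : is_derive t (1 : R) (fun t => expR ((- 2 * p) * t))
      (c * expR ((- 2 * p) * t)).
    rewrite [c * expR _]mulrC.
    exact: (@is_derive1_comp _ expR (fun t => c * t) _ _ _ (is_derive_expR _) dl).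
  have -> : h = (fun t => expR ((- 2 * p) * t)) * (f ^+ 2 + g ^+ 2).
    by apply/funext => s'; rewrite /h !fctE.
  have := is_deriveM de (is_deriveD (is_deriveX 2 (df t)) (is_deriveX 2 (dg t))).
  set D := (X in is_derive _ _ _ X -> _); have -> // : D = 0.
  rewrite {}/D /c /GRing.scale /= !fctE; ring.
have h0 : h 0 = 0 by rewrite /h /f /g x0 !mulmx0 mxE expr0n addr0 mulr0.
have : h T = 0 by rewrite (h_cst T 0).
rewrite /h /f /g xT -!colE !mxE => /eqP.
rewrite mulf_eq0 gt_eqF ?expR_gt0 //= paddr_eq0 ?sqr_ge0 // !sqrf_eq0.
by case/andP => /eqP -> /eqP ->.
Qed.

End RealLyapunov.
(** * The optimal observer *)

Section Observer.
Variable R : realType.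

Lemma shift_lyapunov n (A P : 'M[R]_n) (alpha : R) :
  A *m P + P *m A^T + alpha *: P =
  (A + (alpha / 2)%:M) *m P + P *m (A + (alpha / 2)%:M)^T.
Proof.
rewrite [in RHS]linearD /= tr_scalar_mx mulmxDl mulmxDr mul_scalar_mx mul_mx_scalar.
by rewrite addrACA -scalerDl -splitr.
Qed.

Lemma scale_gram n m (M : 'M[R]_(n, m)) (c : R) : 0 <= c ->
  c *: (M *m M^T) = (Num.sqrt c *: M) *m (Num.sqrt c *: M)^T.
Proof.
by move=> c0; rewrite linearZ /= -scalemxAl -scalemxAr scalerA -expr2 sqr_sqrtr.
Qed.

Lemma stable_shift n (A : 'M[R]_n) (c : R) :
  0 <= c -> stable (A + c%:M) -> stable A.
Proof.
move=> c0 sA l /eigenvalueP [v vA v0].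
have : eigenvalue (map_mx (real_complex R) (A + c%:M)) (l + c%:C%C).
  apply/eigenvalueP; exists v => //.
  by rewrite map_mxD map_scalar_mx mulmxDr vA mul_mx_scalar scalerDl.
move=> /sA; case: l {vA} => x y /=; apply: le_lt_trans.
by rewrite lerDl.
Qed.

Lemma eps_gramian_unique n m p (alpha : R) (S : lti R n m p) (X : 'M[R]_n) :
  eps_norm_defined alpha S ->
  lti_state S *m X + X *m (lti_state S)^T + alpha *: X
    + alpha^-1 *: (lti_input S *m (lti_input S)^T) = 0 ->
  eps_gramian alpha S = X.
Proof.
move=> sS eqX; apply: xget_unique => //= Y eqY.
apply: (lyapunov_unique sS (Q := alpha^-1 *: (lti_input S *m (lti_input S)^T))).
  by rewrite -shift_lyapunov.
by rewrite -shift_lyapunov.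
Qed.

(** For a left eigenvector a + i b with eigenvalue p + i q, adding the values of
    the Lyapunov equation at a and at b cancels the terms in q and leaves
    2 p (a P a^T + b P b^T) = - (|a M|^2 + |b M|^2).  So p <= 0, and p = 0 would
    make a + i b a left eigenvector killed by M. *)
Lemma lyapunov_stable n m (F P : 'M[R]_n) (M : 'M[R]_(n, m)) :
    posdef P -> F *m P + P *m F^T + M *m M^T = 0 ->
    (forall p q (a b : 'rV[R]_n), a *m F = p *: a - q *: b ->
       b *m F = q *: a + p *: b -> a *m M = 0 -> b *m M = 0 -> a = 0 /\ b = 0) ->
  stable F.
Proof.
move=> [symP posP] eqP' unreach l /eigenvalue_real_parts [a [b [ab0 aF bF]]].
move: (complex.Re l) (complex.Im l) aF bF => p q aF bF.
pose f (u v : 'rV[R]_n) := (u *m P *m v^T) 0 0.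
have fC u v : f u v = f v u.
  have tr11 (N : 'M[R]_1) : N 0 0 = N^T 0 0 by rewrite mxE.
  by rewrite /f tr11 !trmx_mul trmxK symP mulmxA.
have f_ge0 u : 0 <= f u u.
  have [->|u0] := eqVneq u 0; first by rewrite /f !mul0mx mxE.
  by have := posP u^T; rewrite trmxK trmx_eq0 => /(_ u0)/ltW.
have f_gt0 u : u != 0 -> 0 < f u u.
  by move=> u0; have := posP u^T; rewrite trmxK trmx_eq0; apply.
have eqf (u : 'rV[R]_n) :
    (u *m F *m P *m u^T) 0 0 *+ 2 + ((u *m M) *m (u *m M)^T) 0 0 = 0.
  have := congr1 (fun N => (u *m N *m u^T) 0 0) eqP'.
  rewrite /= mulmx0 mul0mx [RHS]mxE => <-.
  rewrite !mulmxDr !mulmxDl 2![in RHS]mxE mulr2n trmx_mul !mulmxA.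
  congr (_ + _ + _).
  have -> : u *m P *m F^T *m u^T = u *m P *m (u *m F)^T by rewrite trmx_mul mulmxA.
  exact: fC.
have lin2 r r' (M' N : 'M[R]_1) : (r *: M' + r' *: N) 0 0 = r * M' 0 0 + r' * N 0 0.
  by rewrite !mxE.
have := eqf a; have := eqf b; rewrite aF bF -scaleNr !mulmxDl -!scalemxAl !lin2.
rewrite -/(f a a) -/(f a b) -/(f b a) -/(f b b) (fC b a) => eqb eqa.
have ga := mul_trmx_ge0 (a *m M); have gb := mul_trmx_ge0 (b *m M).
have fab : 0 < f a a + f b b.
  case/orP: ab0 => u0; first by rewrite ltr_pwDl ?f_gt0.
  by rewrite ltr_wpDl ?f_gt0.
have sum0 : (p * (f a a + f b b)) *+ 2 +
    (((a *m M) *m (a *m M)^T) 0 0 + ((b *m M) *m (b *m M)^T) 0 0) = 0.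
  rewrite -[RHS](addr0 0) -[in X in _ = X + _]eqa -[in X in _ = _ + X]eqb.
  by ring.
have p_le0 : p <= 0.
  rewrite -(pmulr_lle0 _ fab) -(pmulrn_lle0 _ (isT : (0 < 2)%N)).
  by rewrite (eqP (etrans (esym (addr_eq0 _ _)) (introT eqP sum0))) oppr_le0 addr_ge0.
rewrite lt_neqAle p_le0 andbT; apply: contraTneq ab0 => p0.
move: sum0; rewrite p0 mul0r mul0rn add0r => /eqP.
rewrite paddr_eq0 // => /andP[/eqP/mul_trmx_eq0 aM /eqP/mul_trmx_eq0 bM].
by have [-> ->] := unreach _ _ _ _ aF bF aM bM; rewrite eqxx.
Qed.

(** Completion of the square.  With W = D D^T one has P C^T = - alpha^-1 L W,
    so the Riccati equation becomes
    A P + P A^T + alpha P = alpha^-1 (L W L^T - B B^T), and the left-hand side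
    below is alpha^-1 (L W L^T - L' W L^T - L W L'^T + L' W L'^T). *)
Lemma riccati_defect n m k (A P : 'M[R]_n) (B : 'M[R]_(n, m))
    (C : 'M[R]_(k, n)) (D : 'M[R]_(k, m)) (alpha : R) (L' : 'M[R]_(n, k)) :
    B *m D^T = 0 -> D *m D^T \in unitmx -> alpha != 0 -> P^T = P ->
    A *m P + P *m A^T + alpha *: P
      - alpha *: (P *m C^T *m invmx (D *m D^T) *m C *m P)
      + alpha^-1 *: (B *m B^T) = 0 ->
  let L := - (alpha *: (P *m C^T *m invmx (D *m D^T))) in
  (A + L' *m C) *m P + P *m (A + L' *m C)^T + alpha *: P
    + alpha^-1 *: ((B + L' *m D) *m (B + L' *m D)^T)
  = alpha^-1 *: (((L' - L) *m D) *m ((L' - L) *m D)^T).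
Proof.
move=> BD uDD a0 symP ric L; pose W := D *m D^T.
have symW : W^T = W by rewrite /W trmx_mul trmxK.
have DB : D *m B^T = 0 by rewrite -[D]trmxK -trmx_mul BD trmx0.
have PC : P *m C^T = - (alpha^-1 *: (L *m W)).
  rewrite mulNmx -scalemxAl mulmxKV // scalerN opprK scalerA mulVf // scale1r //.
have CP : C *m P = - (alpha^-1 *: (W *m L^T)).
  rewrite -[C in LHS]trmxK -[P in LHS]symP -trmx_mul PC.
  by rewrite linearN linearZ /= trmx_mul symW.
have ric' : A *m P + P *m A^T + alpha *: P =
    alpha^-1 *: (L *m W *m L^T) - alpha^-1 *: (B *m B^T).
  have ZE : alpha *: (P *m C^T *m invmx W *m C *m P) = alpha^-1 *: (L *m W *m L^T).
    have -> : alpha *: (P *m C^T *m invmx W *m C *m P) = - (L *m (C *m P)).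
      by rewrite mulNmx opprK -scalemxAl !mulmxA.
    by rewrite CP mulmxN opprK -scalemxAr mulmxA.
  by apply/eqP; rewrite -subr_eq0 opprB addrA addrAC -ZE ric.
have gram (N : 'M[R]_(n, k)) : N *m D *m (N *m D)^T = N *m W *m N^T.
  by rewrite trmx_mul !mulmxA.
have gramB : (B + L' *m D) *m (B + L' *m D)^T = B *m B^T + L' *m W *m L'^T.
  rewrite linearD /= mulmxDl !mulmxDr gram trmx_mul mulmxA BD mul0mx addr0.
  by rewrite -[L' *m D *m B^T]mulmxA DB mulmx0 add0r.
clearbody L W; rewrite gram gramB [in LHS]linearD /=
  trmx_mul mulmxDl mulmxDr (mulmxA P) PC.
rewrite -(mulmxA L') CP addrACA [_ + _ + alpha *: P]addrAC
  ric' [(L' - L)^T]linearB /=.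
rewrite !(mulmxBl, mulmxBr, mulmxN, mulNmx) -!scalemxAl -!scalemxAr !mulmxA.
move: (B *m _) (L *m W *m _) (L' *m W *m _) (L *m W *m _) (L' *m W *m _).
by move=> Z0 Z1 Z2 Z3 Z4; apply/matrixP => i j; rewrite !mxE; ring.
Qed.
End Observer.

Theorem theorem7 (R : realType) (n m k p : nat)
    (A : 'M[R]_n) (B : 'M[R]_(n, m)) (C : 'M[R]_(k, n)) (D : 'M[R]_(k, m))
    (Cz : 'M[R]_(p, n)) (alpha : R) (P : 'M[R]_n)
    (hdet : detectable C A)
    (hctr : controllable A B)
    (hBD : B *m D^T = 0)
    (hDD : D *m D^T \in unitmx)
    (halpha : 0 < alpha)
    (hPpos : posdef P)
    (hPric : A *m P + P *m A^T + alpha *: P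
             - alpha *: (P *m C^T *m invmx (D *m D^T) *m C *m P)
             + alpha^-1 *: (B *m B^T) = 0) :
  let S := error_system A B C D Cz in
  let L := - (alpha *: (P *m C^T *m invmx (D *m D^T))) in
  [/\ stable (A + L *m C),
      eps_norm_defined alpha (S L),
      forall L' : 'M[R]_(n, k), eps_norm_defined alpha (S L') ->
        eps_norm alpha (S L) <= eps_norm alpha (S L')
    & eps_norm alpha (S L) = Num.sqrt (\tr (Cz *m P *m Cz^T))].
Proof.
move=> S L; have a0 : alpha != 0 by rewrite gt_eqF.
have ai0 : 0 <= alpha^-1 by rewrite invr_ge0 ltW.
have [symP _] := hPpos.
have defect L' := riccati_defect L' hBD hDD a0 symP hPric.
have eqL : (A + L *m C) *m P + P *m (A + L *m C)^T + alpha *: P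
    + alpha^-1 *: ((B + L *m D) *m (B + L *m D)^T) = 0.
  by have := defect L; rewrite /= -/L subrr !mul0mx scaler0.
have dS : eps_norm_defined alpha (S L).
  move: eqL; rewrite shift_lyapunov scale_gram // => eqL.
  apply: lyapunov_stable hPpos eqL _ => r q a b aF bF.
  have sq0 : Num.sqrt alpha^-1 != 0 by rewrite gt_eqF // sqrtr_gt0 invr_gt0.
  have unscale (u : 'rV[R]_n) : u *m (Num.sqrt alpha^-1 *: (B + L *m D)) = 0 ->
      u *m L = 0 /\ u *m B = 0.
    rewrite -scalemxAr => /eqP; rewrite scaler_eq0 (negPf sq0) /= => /eqP uM.
    (* Right multiplication by D^T isolates L, because B D^T = 0. *)
    have uL : u *m L = 0.
      rewrite -[u *m L](mulmxK hDD).
      have -> : u *m L *m (D *m D^T) = u *m (B + L *m D) *m D^T.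
        by rewrite -[RHS]mulmxA mulmxDl hBD add0r !mulmxA.
      by rewrite uM !mul0mx.
    by move: uM; rewrite mulmxDr mulmxA uL mul0mx addr0.
  move=> /unscale [aL aB] /unscale [bL bB].
  move: aF bF; rewrite -addrA mulmxDr mulmxDr mul_mx_scalar mulmxA aL mul0mx add0r.
  rewrite mulmxDr mulmxDr mul_mx_scalar mulmxA bL mul0mx add0r => aF bF.
  apply: (@controllable_left_eigenvector _ _ _ A B a b (r - alpha / 2) q hctr) => //.
    by rewrite scalerBl addrAC -aF addrK.
  by rewrite scalerBl addrA -bF addrK.
have normL : eps_norm alpha (S L) = Num.sqrt (\tr (Cz *m P *m Cz^T)).
  by rewrite /eps_norm (eps_gramian_unique dS eqL).
split; [|exact: dS| |exact: normL].
  by apply: stable_shift dS; rewrite ltW // divr_gt0.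
move=> L' dS'; rewrite normL.
(* A solution exists, so the gramian of the other loop is a genuine one and not
   the default value of the choice operator. *)
have [X] := lyapunov_solvable (alpha^-1 *: ((B + L' *m D) *m (B + L' *m D)^T)) dS'.
rewrite -shift_lyapunov => eqX.
rewrite /eps_norm (eps_gramian_unique dS' eqX) /=; apply: ler_wsqrtr.
have symX : X^T = X.
  apply: lyapunov_sym dS' _ _; last by rewrite -shift_lyapunov; exact: eqX.
  by rewrite linearZ /= trmx_mul trmxK.
pose G := Num.sqrt alpha^-1 *: ((L' - L) *m D).
have eqD : (A + L' *m C + (alpha / 2)%:M) *m (X - P)
    + (X - P) *m (A + L' *m C + (alpha / 2)%:M)^T + G *m G^T = 0.
  rewrite -scale_gram // -[_ *: _]defect -shift_lyapunov -[RHS]eqX /=.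
  rewrite mulmxBl mulmxBr scalerBr.
  have regroup (a b c d e f g : 'M[R]_n) :
      a - b + (c - d) + (e - f) + (b + d + f + g) = a + c + e + g.
    by apply/matrixP => i j; rewrite !mxE; ring.
  exact: regroup.
have psd := lyapunov_psd dS' _ eqD.
rewrite -subr_ge0 -linearB /= -mulmxBl -mulmxBr /mxtrace sumr_ge0 // => i _.
have -> : (Cz *m (X - P) *m Cz^T) i i = (row i Cz *m (X - P) *m (row i Cz)^T) 0 0.
  by rewrite -row_mul !mxE; apply: eq_bigr => j _; rewrite !mxE.
by apply: psd; rewrite linearB /= symX symP.
Qed.
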